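(* Let $G=\mathbb{Z}_{q_1}\oplus\cdots\oplus\mathbb{Z}_{q_m}$ (each $q_i$ a prime power) act on a finite set $X$, fix $x\in X$, and let $G'$ and $G'_x$ be as in the context. Suppose $G'_x$ is generated by a single element $g=(a_1,\dots,a_k,0,\dots,0)$ with $1\le k\le m$ and $a_1,\dots,a_k$ nonzero, where for a prime $p$ we have $a_i=p^{r_i}$ and $n_i=p^{t_i}$ for $1\le i\le k$, and $t_i-r_i$ is non-decreasing in $i$. Put $q=z_1^{p^{t_1-r_1}}$ and, for $1\le i\le k-1$, \[ s_i=z_i^{p^{t_i-r_i}-1}\,z_{i+1}^{p^{(t_{i+1}-r_{i+1})-(t_i-r_i)}}, \] and \[ F(z_1,\dots,z_m)=\left(1+q+\cdots+q^{p^{r_1}-1}\right)\prod_{i=1}^{k-1}\left(1+s_i+\cdots+s_i^{p^{t_i-r_i+r_{i+1}}-1}\right)\prod_{i=k+1}^m\left(1+z_i+z_i^2+\cdots+z_i^{n_i-1}\right). \] Then for every $(b_1,\dots,b_m)\in G'$, the number of points of the orbit $G\cdot x$ fixed by $(b_1,\dots,b_m)$ equals $F(\zeta_{n_1}^{b_1},\dots,\zeta_{n_m}^{b_m})$.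
   Context: Let $e_i$ denote the $i$-th standard generator of $G$. For the fixed $x\in X$, let $n_i$ be the smallest positive integer with $(n_ie_i)\cdot x=x$, and let $G'=\mathbb{Z}_{n_1}\oplus\cdots\oplus\mathbb{Z}_{n_m}$. Since $G$ is abelian, $G'$ acts on the orbit $G\cdot x$ by $(b_1,\dots,b_m)\cdot y=(b_1e_1+\cdots+b_me_m)\cdot y$; $G'_x$ denotes the stabilizer of $x$ under this action. Elements of $G'$ are represented as $m$-tuples $(a_1,\dots,a_m)$ of integers with $0\le a_i<n_i$. $\zeta_n=e^{2\pi i/n}$. *)

(* Defs.v *)
From HB Require Import structures.
From mathcomp Require Import all_boot all_order all_algebra all_fingroup.
From mathcomp Require Import all_classical all_reals all_analysis.
From mathcomp Require Import complex.

Set Implicit Arguments.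
Unset Strict Implicit.
Unset Printing Implicit Defensive.

Import GroupScope GRing.Theory.

(* 'Z_n is not usable here: it is Z/2 when n = 1, and the moduli n_i ([period]
   below) may well be 1.  The carrier 'I_(n.-1.+1) is Z/n for every n > 0; it is never
   used with n = 0. *)
Definition Zmod (n : nat) : finGroupType := 'I_n.-1.+1.

(* The representative of a class in {0, ..., n - 1}. *)
Definition Zmod_val (n : nat) (a : Zmod n) : nat := nat_of_ord a.

(* The direct sum of the Z/(q i).  Its law is written multiplicatively, as for
   all finGroupTypes. *)
Definition Zsum (m : nat) (q : 'I_m -> nat) : finGroupType :=
  {dffun forall i : 'I_m, Zmod (q i)}.

Definition coordinate (m : nat) (q : 'I_m -> nat) (b : Zsum q) (i : 'I_m) : nat :=
  Zmod_val (b i).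

Definition generator (m : nat) (q : 'I_m -> nat) (i : 'I_m) : Zsum q :=
  @dfung1 'I_m (fun j => Zmod (q j)) i (inZp 1).

Definition prime_power (q : nat) : Prop :=
  exists p e : nat, [/\ prime p, 0 < e & q = p ^ e]%N.

Lemma Zsum_mulC (m : nat) (q : 'I_m -> nat) (a b : Zsum q) : a * b = b * a.
Proof.
apply/ffunP=> i; rewrite !(@dffunM 'I_m (fun j => Zmod (q j))).
exact: Zp_mulgC.
Qed.

Lemma period_exists (m : nat) (q : 'I_m -> nat) (X : finType)
    (to : {action Zsum q &-> X}) (x : X) (i : 'I_m) :
  exists n : nat, (0 < n)%N && (to x (generator q i ^+ n) == x).
Proof.
by exists #[generator q i]; rewrite order_gt0 expg_order act1 eqxx.
Qed.

Definition period (m : nat) (q : 'I_m -> nat) (X : finType)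
    (to : {action Zsum q &-> X}) (x : X) (i : 'I_m) : nat :=
  ex_minn (period_exists to x i).

Definition Gprime (m : nat) (q : 'I_m -> nat) (X : finType)
    (to : {action Zsum q &-> X}) (x : X) : finGroupType :=
  Zsum (period to x).

(* b_1 e_1 + ... + b_m e_m, in multiplicative notation. *)
Definition lift_Gprime (m : nat) (q : 'I_m -> nat) (X : finType)
    (to : {action Zsum q &-> X}) (x : X) (b : Gprime to x) : Zsum q :=
  \prod_(i < m) generator q i ^+ coordinate b i.

Definition orbit_type (m : nat) (q : 'I_m -> nat) (X : finType)
    (to : {action Zsum q &-> X}) (x : X) : finType :=
  {y : X | y \in orbit to [set: Zsum q] x}.

Lemma orbit_base_proof (m : nat) (q : 'I_m -> nat) (X : finType)
    (to : {action Zsum q &-> X}) (x : X) : x \in orbit to [set: Zsum q] x.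
Proof. exact: orbit_refl. Qed.

Definition orbit_base (m : nat) (q : 'I_m -> nat) (X : finType)
    (to : {action Zsum q &-> X}) (x : X) : orbit_type to x :=
  exist _ x (orbit_base_proof to x).

Lemma Gprime_act_proof (m : nat) (q : 'I_m -> nat) (X : finType)
    (to : {action Zsum q &-> X}) (x : X) (y : orbit_type to x)
    (b : Gprime to x) :
  to (val y) (lift_Gprime b) \in orbit to [set: Zsum q] x.
Proof.
case: y => y /= /orbitP[a _ <-]; apply/orbitP.
by exists (a * lift_Gprime b); rewrite ?inE ?actM.
Qed.

Definition Gprime_act (m : nat) (q : 'I_m -> nat) (X : finType)
    (to : {action Zsum q &-> X}) (x : X) (y : orbit_type to x)
    (b : Gprime to x) : orbit_type to x :=
  exist _ (to (val y) (lift_Gprime b)) (Gprime_act_proof y b).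

Lemma period_gt0 (m : nat) (q : 'I_m -> nat) (X : finType)
    (to : {action Zsum q &-> X}) (x : X) (i : 'I_m) : (0 < period to x i)%N.
Proof. by rewrite /period; case: ex_minnP => n /andP[]. Qed.

Lemma act_generator_period (m : nat) (q : 'I_m -> nat) (X : finType)
    (to : {action Zsum q &-> X}) (x : X) (i : 'I_m) :
  to x (generator q i ^+ period to x i) = x.
Proof. by rewrite /period; case: ex_minnP => n /andP[_ /eqP]. Qed.

Lemma act_generator_mod (m : nat) (q : 'I_m -> nat) (X : finType)
    (to : {action Zsum q &-> X}) (x : X) (i : 'I_m) (y : X) (l : nat) :
  y \in orbit to [set: Zsum q] x ->
  to y (generator q i ^+ (l %% period to x i)) = to y (generator q i ^+ l).
Proof.
move=> /orbitP[a _ <-].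
rewrite -!actM !(Zsum_mulC a) !actM; congr (to _ a).
rewrite [in RHS](divn_eq l (period to x i)) expgD actM; congr (to _ _).
elim: (l %/ _) => [|c IH]; first by rewrite mul0n expg0 act1.
by rewrite mulSn expgD actM act_generator_period.
Qed.

Lemma Gprime_act_is_action (m : nat) (q : 'I_m -> nat) (X : finType)
    (to : {action Zsum q &-> X}) (x : X) :
  is_action [set: Gprime to x] (@Gprime_act m q X to x).
Proof.
pose lift (s : seq 'I_m) (b : Gprime to x) : Zsum q :=
  \prod_(i <- s) generator q i ^+ coordinate b i.
have inO (z : X) (a : Zsum q) : z \in orbit to [set: Zsum q] x ->
    to z a \in orbit to [set: Zsum q] x.
  by move=> /orbitP[a' _ <-]; apply/orbitP; exists (a' * a); rewrite ?inE ?actM.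
have liftM (s : seq 'I_m) (y : X) (b c : Gprime to x) :
    y \in orbit to [set: Zsum q] x ->
    to y (lift s (b * c)) = to y (lift s b * lift s c).
  elim: s y => [|i s IH] y yO; first by rewrite /lift !big_nil mulg1.
  rewrite /lift !big_cons -!/(lift s _) [in LHS]actM.
  have -> : coordinate (b * c) i =
      ((coordinate b i + coordinate c i) %% period to x i)%N.
    rewrite /coordinate (@dffunM 'I_m (fun j => Zmod (period to x j))).
    by rewrite /Zmod_val /=; congr (_ %% _)%N; rewrite prednK ?period_gt0.
  rewrite act_generator_mod // expgD IH ?inO // -actM; congr (to _ _).
  rewrite -!mulgA; congr (_ * _); rewrite !mulgA; congr (_ * _).
  exact: Zsum_mulC.
split.
  by move=> b y z /(congr1 val) /= /act_inj; exact: val_inj.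
move=> y b c _ _; apply: val_inj => /=.
rewrite -actM; exact: liftM (valP y).
Qed.

Definition Gprime_action (m : nat) (q : 'I_m -> nat) (X : finType)
    (to : {action Zsum q &-> X}) (x : X) :
    {action Gprime to x &-> orbit_type to x} :=
  Action (Gprime_act_is_action to x).

Local Open Scope ring_scope.
Import complex.

Definition zeta (R : realType) (n : nat) : R[i] :=
  (cos (2 * pi / n%:R) +i* sin (2 * pi / n%:R))%C.

(* Coordinates are numbered from 0, so z_1 is z ord0, and the factor of index
   i <= k - 1 of the middle product is the one with i.+1 < k here.  [ordS i] is
   the successor of i, cyclic in general, but k <= m.+1 excludes wrapping. *)
Definition F_q (C : comNzRingType) (m p : nat) (r t : 'I_m.+1 -> nat)
    (z : 'I_m.+1 -> C) : C :=
  z ord0 ^+ (p ^ (t ord0 - r ord0)).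

Definition F_s (C : comNzRingType) (m p : nat) (r t : 'I_m.+1 -> nat)
    (z : 'I_m.+1 -> C) (i : 'I_m.+1) : C :=
  z i ^+ (p ^ (t i - r i) - 1) *
  z (ordS i) ^+ (p ^ ((t (ordS i) - r (ordS i)) - (t i - r i))).

Definition F (C : comNzRingType) (m p k : nat) (r t n : 'I_m.+1 -> nat)
    (z : 'I_m.+1 -> C) : C :=
  (\sum_(j < p ^ r ord0) F_q p r t z ^+ j) *
  (\prod_(i < m.+1 | (i.+1 < k)%N)
     \sum_(j < p ^ (t i - r i + r (ordS i))) F_s p r t z i ^+ j) *
  (\prod_(i < m.+1 | (k <= i)%N) \sum_(j < n i) z i ^+ j).

(* Main.v *)
Require Import Defs.
From HB Require Import structures.
From mathcomp Require Import all_boot all_order all_algebra all_fingroup.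
From mathcomp Require Import all_classical all_reals all_analysis.
From mathcomp Require Import complex ring.

(** The group G' is abelian and acts transitively on the orbit of x, so b fixes
    either every point or none, according to whether b is in <g> or not; and the
    orbit has n_1 ... n_m / p^(t_k - r_k) points.  In F, every factor is a
    geometric sum over a root of unity.  If the factor in q does not vanish then
    b_1 = c p^(r_1) for some c; once b_i = c p^(r_i) mod p^(t_i), s_i is a root of
    unity of order dividing N = p^(t_i - r_i + r_(i+1)), and the i-th sum is
    nonzero iff b_(i+1) = c p^(r_(i+1)) mod N.  Since t_i - r_i is non-decreasing,
    these congruences can be glued along i into a single c with b = c g. *)

Set Implicit Arguments.
Unset Strict Implicit.
Unset Printing Implicit Defensive.

Import GroupScope GRing.Theory.
Import Order.TTheory Num.Theory.
Local Open Scope ring_scope.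

(** * Powers of [zeta] and geometric sums over roots of unity *)

Lemma zetaX (R : realType) (n j : nat) :
  zeta R n ^+ j =
  (cos (2 * pi * j%:R / n%:R) +i* sin (2 * pi * j%:R / n%:R))%C.
Proof.
elim: j => [|j IH].
  by rewrite expr0 mulr0 mul0r cos0 sin0.
rewrite exprS IH /zeta.
have -> : 2 * pi * j.+1%:R / n%:R =
    2 * pi / n%:R + 2 * pi * j%:R / n%:R :> R by rewrite -natr1; ring.
rewrite cosD sinD; apply/eqP; rewrite eq_complex /= eqxx /=.
by apply/eqP; ring.
Qed.

Lemma zeta_order (R : realType) (n : nat) : (0 < n)%N -> zeta R n ^+ n = 1.
Proof.
move=> n_gt0; rewrite zetaX mulfK ?pnatr_eq0 -?lt0n //.
have -> : 2 * pi = pi *+ 2 :> R by rewrite mulr2n; ring.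
by rewrite cos2pi sin2pi.
Qed.

(** After reducing [j] to a remainder [l < n], the real part decides. If [0 < l], then
    [h = pi * l / n] lies strictly between 0 and pi, and [cos (2h) = 1] compared with
    [cos^2 h + sin^2 h = 1] would force [sin h = 0]. *)
Lemma zetaX_eq1 (R : realType) (n j : nat) :
  (0 < n)%N -> (zeta R n ^+ j == 1) = (n %| j)%N.
Proof.
move=> n_gt0; rewrite (divn_eq j n) exprD mulnC exprM zeta_order // expr1n mul1r.
rewrite dvdn_addr ?dvdn_mulr //.
have lt_ln : (j %% n < n)%N by rewrite ltn_pmod.
move: (j %% n)%N lt_ln => l lt_ln.
have [->|l_gt0] := posnP l; first by rewrite expr0 eqxx dvdn0.
rewrite [RHS]gtnNdvd //; apply/negP.
rewrite zetaX eq_complex /= => /andP[/eqP cos1 _].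
pose h : R := pi * l%:R / n%:R.
have n0 : 0 < n%:R :> R by rewrite ltr0n.
have h_gt0 : 0 < h by rewrite !mulr_gt0 ?invr_gt0 ?pi_gt0 ?ltr0n.
have h_ltpi : h < pi by rewrite ltr_pdivrMr // ltr_pM2l ?pi_gt0 // ltr_nat.
have /eqP := cos1.
have -> : 2 * pi * l%:R / n%:R = h + h by rewrite /h; ring.
have s0 : 0 < sin h by apply: sin_gt0_pi; rewrite h_gt0.
rewrite cosD -[X in _ == X](cos2Dsin2 h) => /eqP /addrI /eqP.
rewrite -!expr2 eq_sym -subr_eq0 opprK -mulr2n mulrn_eq0 /= sqrf_eq0.
by rewrite gt_eqF.
Qed.

Lemma zeta_mulX (R : realType) (a n : nat) :
  (0 < a)%N -> zeta R (a * n) ^+ a = zeta R n.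
Proof.
move=> a_gt0; rewrite zetaX /zeta.
suff -> : 2 * pi * a%:R / (a * n)%:R = 2 * pi / n%:R :> R by [].
by rewrite natrM invfM mulrA mulfK // pnatr_eq0 -lt0n.
Qed.

Lemma sum_powers_unity (K : fieldType) (N : nat) (s : K) : s ^+ N = 1 ->
  \sum_(j < N) s ^+ j = if s == 1 then N%:R else 0.
Proof.
move=> sN; case: eqVneq => [->|s1].
  by under eq_bigr do rewrite expr1n; rewrite sumr_const card_ord.
apply: (mulfI (x := s - 1)); first by rewrite subr_eq0.
by rewrite -subrX1 sN subrr mulr0.
Qed.

(** * The factors of [F] as geometric sums *)

Lemma F_qE (R : realType) (m p : nat) (r t n b : 'I_m.+1 -> nat) :
  (0 < p)%N -> (r ord0 <= t ord0)%N -> n ord0 = (p ^ t ord0)%N ->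
  F_q p r t (fun i => zeta R (n i) ^+ b i) = zeta R (p ^ r ord0) ^+ b ord0.
Proof.
move=> p_gt0 le_rt nE; rewrite /F_q nE -exprM mulnC exprM; congr (_ ^+ _).
by rewrite -{1}(subnK le_rt) expnD zeta_mulX // expn_gt0 p_gt0.
Qed.

(** Only the exponent modulo [p ^ t] matters, and raising to the power [p ^ r] lowers the order from
    [p ^ t] to [p ^ (t - r)]. *)
Lemma zeta_expn_eqmod (R : realType) (p t r b c : nat) :
  (0 < p)%N -> (r <= t)%N -> b = c * p ^ r %[mod p ^ t] ->
  zeta R (p ^ t) ^+ b = zeta R (p ^ (t - r)) ^+ c.
Proof.
move=> p_gt0 le_rt bE; have pX_gt0 e : (0 < p ^ e)%N by rewrite expn_gt0 p_gt0.
rewrite -(expr_mod b (zeta_order R (pX_gt0 t))) bE expr_mod ?zeta_order //.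
rewrite mulnC exprM; congr (_ ^+ _).
by rewrite -{1}(subnKC le_rt) expnD zeta_mulX.
Qed.

(* The hypothesis [b i = c * p ^ r i] is what makes [s_i] a root of unity of
   order dividing the number of terms of its geometric sum; it need not be one
   in general. *)
Lemma F_sE (R : realType) (m p : nat) (r t n b : 'I_m.+1 -> nat)
    (i : 'I_m.+1) (c : nat) :
  (0 < p)%N -> (r i <= t i)%N -> (r (ordS i) <= t (ordS i))%N ->
  (t i - r i <= t (ordS i) - r (ordS i))%N ->
  n i = (p ^ t i)%N -> n (ordS i) = (p ^ t (ordS i))%N ->
  b i = c * p ^ r i %[mod p ^ t i] ->
  F_s p r t (fun i => zeta R (n i) ^+ b i) i =
  zeta R (p ^ (t i - r i + r (ordS i))) ^+
    (b (ordS i) + c * p ^ r (ordS i) * (p ^ (t i - r i) - 1)).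
Proof.
move=> p_gt0; rewrite /F_s; move: (ordS i) => j le_i le_j le_u ni nj bE.
have pX_gt0 e : (0 < p ^ e)%N by rewrite expn_gt0 p_gt0.
rewrite ni nj (zeta_expn_eqmod R p_gt0 le_i bE) mulrC exprD; congr (_ * _).
  rewrite -exprM mulnC exprM; congr (_ ^+ _).
  have {1}-> : t j = (t j - r j - (t i - r i) + (t i - r i + r j))%N.
    by rewrite addnA subnK // subnK.
  by rewrite expnD zeta_mulX.
rewrite exprM; congr (_ ^+ _); rewrite mulnC exprM; congr (_ ^+ _).
by rewrite addnC expnD zeta_mulX.
Qed.

(** Modulo [P * N], the term [c * N * (P - 1)] is the negative of [c * N]. With
    [P = p ^ (t i - r i)] and [N = p ^ r (ordS i)], this turns the exponent found in [F_sE] into a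
    congruence. *)
Lemma dvdn_add_predMl (N P b c : nat) : (0 < P)%N ->
  (P * N %| b + c * N * (P - 1))%N = (b == c * N %[mod P * N]).
Proof.
move=> P_gt0; rewrite /dvdn -(eqn_modDr (c * N * (P - 1))); congr (_ == _).
rewrite -{1}[(c * N)%N]muln1 -mulnDr subnKC //.
by rewrite -mulnA [(N * P)%N]mulnC modnMl.
Qed.

Lemma geometric_sum_F_s (R : realType) (m p : nat) (r t n b : 'I_m.+1 -> nat)
    (i : 'I_m.+1) (c : nat) :
  (0 < p)%N -> (r i <= t i)%N -> (r (ordS i) <= t (ordS i))%N ->
  (t i - r i <= t (ordS i) - r (ordS i))%N ->
  n i = (p ^ t i)%N -> n (ordS i) = (p ^ t (ordS i))%N ->
  b i = c * p ^ r i %[mod p ^ t i] ->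
  \sum_(j < p ^ (t i - r i + r (ordS i)))
     F_s p r t (fun i => zeta R (n i) ^+ b i) i ^+ j =
  if (b (ordS i) == c * p ^ r (ordS i) %[mod p ^ (t i - r i + r (ordS i))])%N
  then (p ^ (t i - r i + r (ordS i)))%:R else 0.
Proof.
move=> p_gt0 le_i le_j le_u ni nj bE.
have pX_gt0 e : (0 < p ^ e)%N by rewrite expn_gt0 p_gt0.
rewrite (F_sE R p_gt0 le_i le_j le_u ni nj bE) sum_powers_unity.
  by rewrite zetaX_eq1 // expnD dvdn_add_predMl.
by rewrite exprAC zeta_order // expr1n.
Qed.

Lemma geometric_sum_F_q (R : realType) (m p : nat) (r t n b : 'I_m.+1 -> nat) :
  (0 < p)%N -> (r ord0 <= t ord0)%N -> n ord0 = (p ^ t ord0)%N ->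
  \sum_(j < p ^ r ord0) F_q p r t (fun i => zeta R (n i) ^+ b i) ^+ j =
  if (p ^ r ord0 %| b ord0)%N then (p ^ r ord0)%:R else 0.
Proof.
move=> p_gt0 le_rt nE; have pX_gt0 e : (0 < p ^ e)%N by rewrite expn_gt0 p_gt0.
rewrite F_qE // sum_powers_unity ?zetaX_eq1 //.
by rewrite exprAC zeta_order // expr1n.
Qed.

Lemma geometric_sum_zeta (R : realType) (n b : nat) : (0 < n)%N ->
  \sum_(j < n) (zeta R n ^+ b) ^+ j = if (n %| b)%N then n%:R else 0.
Proof.
move=> n_gt0; rewrite sum_powers_unity ?zetaX_eq1 //.
by rewrite exprAC zeta_order // expr1n.
Qed.

(** Since [p ^ r] divides both the modulus and [c * p ^ r], it divides [b], and [c'] is the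
    quotient. The new multiplier gives [b] exactly, hence modulo any power of [p], while its class
    modulo [p ^ u] is still that of [c]. *)
Lemma prime_power_glue (p u r b c : nat) : (0 < p)%N ->
  b = c * p ^ r %[mod p ^ (u + r)] ->
  exists2 c', b = (c' * p ^ r)%N & c' = c %[mod p ^ u].
Proof.
move=> p_gt0 bE; have pr_gt0 : (0 < p ^ r)%N by rewrite expn_gt0 p_gt0.
have /dvdnP[c' b_c'] : (p ^ r %| b)%N.
  rewrite /dvdn -(@modn_dvdm (p ^ (u + r))) ?dvdn_exp2l ?leq_addl // bE.
  by rewrite modn_dvdm ?dvdn_exp2l ?leq_addl // modnMl.
exists c' => //; move: bE; rewrite b_c' expnD -!muln_modl => /eqP.
by rewrite eqn_pmul2r // => /eqP.
Qed.

Lemma val_ordS (m : nat) (i : 'I_m.+1) : (i.+1 < m.+1)%N -> ordS i = i.+1 :> nat.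
Proof. by move=> lt_im; rewrite /= modn_small. Qed.

(** * Coordinatewise arithmetic in a direct sum of cyclic groups *)

Lemma coordinateM (m : nat) (q : 'I_m -> nat) (a b : Zsum q) (i : 'I_m) :
  (0 < q i)%N ->
  coordinate (a * b)%g i = ((coordinate a i + coordinate b i) %% q i)%N.
Proof.
move=> qi_gt0; rewrite /coordinate (@dffunM 'I_m (fun j => Zmod (q j))).
by congr (_ %% _)%N; rewrite prednK.
Qed.

Lemma ltn_coordinate (m : nat) (q : 'I_m -> nat) (a : Zsum q) (i : 'I_m) :
  (0 < q i)%N -> (coordinate a i < q i)%N.
Proof.
by move=> qi_gt0; rewrite -[X in (_ < X)%N](prednK qi_gt0); exact: ltn_ord.
Qed.

Lemma coordinate1 (m : nat) (q : 'I_m -> nat) (i : 'I_m) :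
  coordinate (1%g : Zsum q) i = 0%N.
Proof. by rewrite /coordinate ffunE. Qed.

Lemma coordinateX (m : nat) (q : 'I_m -> nat) (a : Zsum q) (n : nat) (i : 'I_m) :
  (0 < q i)%N -> coordinate (a ^+ n)%g i = ((n * coordinate a i) %% q i)%N.
Proof.
move=> qi_gt0; elim: n => [|n IH]; first by rewrite expg0 coordinate1 mul0n mod0n.
by rewrite expgS coordinateM // IH modnDmr mulSn.
Qed.

Lemma coordinate_inj (m : nat) (q : 'I_m -> nat) (a b : Zsum q) :
  coordinate a =1 coordinate b -> a = b.
Proof. by move=> eq_ab; apply/ffunP => i; apply: val_inj; exact: eq_ab. Qed.

Lemma coordinate_generatorX (m : nat) (q : 'I_m -> nat) (i j : 'I_m) (n : nat) :
  (0 < q j)%N ->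
  coordinate (generator q i ^+ n)%g j = if i == j then (n %% q j)%N else 0%N.
Proof.
move=> qj_gt0; rewrite coordinateX // /generator /coordinate.
case: eqVneq => [->|neq_ij].
  rewrite (@dfung1_id 'I_m (fun j => Zmod (q j))).
  by rewrite /Zmod_val /= prednK // modnMmr muln1.
by rewrite (@dfung1_dflt 'I_m (fun j => Zmod (q j))) // muln0 mod0n.
Qed.

Lemma Zsum_decomposition (m : nat) (q : 'I_m -> nat) (a : Zsum q) :
  (forall i, 0 < q i)%N -> a = (\prod_(i < m) generator q i ^+ coordinate a i)%g.
Proof.
move=> q_gt0; apply: coordinate_inj => j.
(* Induction needs partial products; [uniq s] ensures that each generator contributes only once. *)
have prod_coord (s : seq 'I_m) : uniq s ->
    coordinate (\prod_(i <- s) generator q i ^+ coordinate a i)%g j =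
    if j \in s then coordinate a j else 0%N.
  elim: s => [_|i s IH /= /andP[i_s /IH eqs]].
    by rewrite big_nil coordinate1.
  rewrite big_cons coordinateM // eqs coordinate_generatorX // in_cons.
  have lt_aj := @ltn_coordinate m q a j (q_gt0 j).
  have [<-|] := eqVneq i j.
    by rewrite (negPf i_s) addn0 modn_mod modn_small // ltn_coordinate.
  by rewrite /= add0n modn_small //; case: ifP.
by rewrite prod_coord ?index_enum_uniq // mem_index_enum.
Qed.

Lemma card_Zsum (m : nat) (q : 'I_m -> nat) :
  (forall i, 0 < q i)%N -> #|Zsum q| = (\prod_(i < m) q i)%N.
Proof.
move=> q_gt0; rewrite card_dep_ffun foldrE big_map big_enum.
by apply: eq_bigr => i _; rewrite card_ord prednK.
Qed.

Lemma Zsum_cycleP (m : nat) (q : 'I_m -> nat) (g b : Zsum q) :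
  (forall i, 0 < q i)%N ->
  reflect (exists c, forall i, coordinate b i = (c * coordinate g i) %% q i)%N
          (b \in <[g]>%g).
Proof.
move=> q_gt0; apply: (iffP (fingroup.cycleP _ _)) => -[c].
  by move=> ->; exists c => i; rewrite coordinateX.
by move=> bE; exists c; apply: coordinate_inj => i; rewrite coordinateX.
Qed.

Lemma Zsum_order_dvdn (m : nat) (q : 'I_m -> nat) (g : Zsum q) (d : nat) :
  (forall i, 0 < q i)%N ->
  reflect (forall i, q i %| d * coordinate g i)%N (#[g]%g %| d)%N.
Proof.
move=> q_gt0; rewrite cyclic.order_dvdn; apply: (iffP eqP) => [gd1 i|dvd_q].
  by rewrite /dvdn -coordinateX // gd1 coordinate1.
apply: coordinate_inj => i; rewrite coordinateX // coordinate1.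
exact/eqP/dvd_q.
Qed.

(** * The action of G' on the orbit and its fixed points *)

Lemma Gprime_surj (m : nat) (q : 'I_m -> nat) (X : finType)
    (to : {action Zsum q &-> X}) (x : X) (a : Zsum q) :
  (forall i, 0 < q i)%N -> exists b : Gprime to x, to x (lift_Gprime b) = to x a.
Proof.
move=> q_gt0.
pose b : Gprime to x := [ffun i => inZp (coordinate a i)].
have bE i : coordinate b i = (coordinate a i %% period to x i)%N.
  by rewrite /coordinate ffunE /Zmod_val /= prednK ?period_gt0.
exists b; rewrite [in RHS](Zsum_decomposition a q_gt0) /lift_Gprime.
(* The base point varies along the induction: each generator moves it, but within the orbit of [x],
   where exponents may be reduced modulo the period. *)
suff act_prod (s : seq 'I_m) (y : X) : y \in orbit to [set: Zsum q] x ->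
    to y (\prod_(i <- s) generator q i ^+ coordinate b i)%g =
    to y (\prod_(i <- s) generator q i ^+ coordinate a i)%g.
  exact: act_prod (orbit_base_proof to x).
elim: s y => [|i s IH] y yO; first by rewrite !big_nil.
rewrite !big_cons !actM bE act_generator_mod //; apply: IH.
by move: yO => /orbitP[a' _ <-]; rewrite -actM mem_orbit ?inE.
Qed.

Lemma Gprime_transitive (m : nat) (q : 'I_m -> nat) (X : finType)
    (to : {action Zsum q &-> X}) (x : X) : (forall i, 0 < q i)%N ->
  orbit (Gprime_action to x) [set: Gprime to x] (orbit_base to x) = [set: _].
Proof.
move=> q_gt0; apply/setP => y; rewrite inE; apply/orbitP.
have /orbitP[a _ aE] := valP y.
have [b bE] := Gprime_surj to x a q_gt0.
by exists b; rewrite ?inE //; apply: val_inj; rewrite /= bE.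
Qed.

(** Every point is the image of [x] under some [a], and [b] commutes with [a], so [b] fixes that
    point exactly when it fixes [x]. *)
Lemma card_fix_transitive_abelian (aT : finGroupType) (T : finType)
    (to : {action aT &-> T}) (x : T) (b : aT) :
  abelian [set: aT] -> orbit to [set: aT] x = [set: T] ->
  #|'Fix_([set: T] | to)[b]%g| = (if b \in 'C[x | to]%g then #|T| else 0)%N.
Proof.
move=> abT trT; rewrite finset.setTI.
have fix_const y : (y \in 'Fix_to[b]%g) = (b \in 'C[x | to]%g).
  have /orbitP[a _ <-] : y \in orbit to [set: aT] x by rewrite trT inE.
  have comm_ab : commute a b by apply: (centsP abT); rewrite inE.
  apply/afix1P/astab1P; rewrite -actM comm_ab actM; first exact: act_inj.
  by move=> ->.
case: ifP fix_const => _ fix_const; last exact: eq_card0.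
by apply: eq_card => y; rewrite fix_const.
Qed.

(** * The value of [F] on and off the subgroup generated by [g] *)

(** Here [k] is the last index, counted from 0. Each [r (ordS i)] pairs with the next difference
    [t - r] to give a full exponent [t]; the outer factors supply the two missing ends. *)
Lemma prod_exponents_telescope (m p k : nat) (r t : 'I_m.+1 -> nat) :
  (k < m.+1)%N -> (forall i : 'I_m.+1, i <= k -> r i <= t i)%N ->
  (p ^ r ord0 * (\prod_(i < m.+1 | i < k) p ^ (t i - r i + r (ordS i))) *
     p ^ (t (inord k) - r (inord k)) = \prod_(i < m.+1 | i <= k) p ^ t i)%N.
Proof.
elim: k => [|k IH] lt_km le_rt.
  rewrite big_pred0 // muln1 -expnD.
  have -> : inord 0 = ord0 :> 'I_m.+1 by apply: ord_inj; rewrite inordK.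
  by rewrite subnKC ?le_rt // (big_pred1 ord0) // => i; rewrite leqn0.
have k_lt : (k < m.+1)%N := ltnW lt_km.
have kE : (inord k : 'I_m.+1) = k :> nat by rewrite inordK.
have k1E : (inord k.+1 : 'I_m.+1) = k.+1 :> nat by rewrite inordK.
have ordSk : ordS (inord k) = inord k.+1 :> 'I_m.+1.
  by apply: ord_inj; rewrite k1E val_ordS kE.
rewrite (bigD1 (inord k)) /= ?kE ?ltnSn // [RHS](bigD1 (inord k.+1)) /= ?k1E //.
rewrite (eq_bigl (fun i : 'I_m.+1 => i < k)%N); last first.
  by move=> i; rewrite -val_eqE /= kE ltnS ltn_neqAle andbC.
rewrite [in RHS](eq_bigl (fun i : 'I_m.+1 => i <= k)%N); last first.
  by move=> i; rewrite -val_eqE /= k1E -[(i <= k)%N]ltnS ltn_neqAle andbC.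
rewrite -IH //; last by move=> i le_ik; apply: le_rt; exact: leqW.
have tE : (p ^ t (inord k.+1) =
    p ^ (t (inord k.+1) - r (inord k.+1)) * p ^ r (inord k.+1))%N.
  by rewrite -expnD subnK // le_rt ?k1E.
by rewrite ordSk expnD tE; ring.
Qed.

(** The case of [b] in the subgroup generated by [g]: all the roots of unity being summed equal 1,
    so each sum is its number of terms. *)
Lemma F_eq_card (R : realType) (m p k : nat) (r t n b : 'I_m.+1 -> nat) (c : nat) :
  (0 < p)%N -> (1 <= k)%N -> (k <= m.+1)%N ->
  (forall i, 0 < n i)%N ->
  (forall i : 'I_m.+1, i < k -> r i <= t i)%N ->
  (forall i : 'I_m.+1, (i < k)%N -> n i = (p ^ t i)%N) ->
  (forall i j : 'I_m.+1, i <= j -> j < k -> t i - r i <= t j - r j)%N ->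
  (forall i : 'I_m.+1, (i < k)%N -> b i = c * p ^ r i %[mod p ^ t i]) ->
  (forall i : 'I_m.+1, (k <= i)%N -> n i %| b i)%N ->
  F p k r t n (fun i => zeta R (n i) ^+ b i) =
  (p ^ r ord0 * (\prod_(i < m.+1 | i.+1 < k) p ^ (t i - r i + r (ordS i))) *
     \prod_(i < m.+1 | k <= i) n i)%N%:R.
Proof.
move=> p_gt0 k_gt0 le_km n_gt0 le_rt nE le_u bE b0; rewrite /F !natrM !natr_prod.
have pX_gt0 e : (0 < p ^ e)%N by rewrite expn_gt0 p_gt0.
congr (_ * _ * _).
- rewrite geometric_sum_F_q ?le_rt ?nE //.
  rewrite /dvdn -(@modn_dvdm (p ^ t ord0)) ?dvdn_exp2l ?le_rt // bE //.
  by rewrite modn_dvdm ?dvdn_exp2l ?le_rt // modnMl eqxx.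
- apply: eq_bigr => i lt_ik; have lt_ik' := ltnW lt_ik.
  have iS := val_ordS (leq_trans lt_ik le_km).
  rewrite (@geometric_sum_F_s R m p r t n b i c) ?le_rt ?nE ?le_u ?bE ?iS //.
  (* This is monotonicity of [t - r] rearranged; it lets the congruence on the next coordinate be
     weakened to the modulus of the geometric sum. *)
  have dvd_j : (p ^ (t i - r i + r (ordS i)) %| p ^ t (ordS i))%N.
    by rewrite dvdn_exp2l // addnC -leq_subRL ?le_u ?le_rt ?iS.
  by rewrite -(modn_dvdm _ dvd_j) bE ?iS // modn_dvdm // eqxx.
- by apply: eq_bigr => i le_ki; rewrite geometric_sum_zeta ?b0.
Qed.

(** The converse direction: no factor vanishes, so each one yields its congruence, and the
    multiplier [c] is corrected from one index to the next. *)
Lemma F_neq0_congruence (R : realType) (m p k : nat)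
    (r t n b : 'I_m.+1 -> nat) :
  (0 < p)%N -> (1 <= k)%N -> (k <= m.+1)%N ->
  (forall i, 0 < n i)%N ->
  (forall i : 'I_m.+1, i < k -> r i <= t i)%N ->
  (forall i : 'I_m.+1, (i < k)%N -> n i = (p ^ t i)%N) ->
  (forall i j : 'I_m.+1, i <= j -> j < k -> t i - r i <= t j - r j)%N ->
  F p k r t n (fun i => zeta R (n i) ^+ b i) != 0 ->
  (forall i : 'I_m.+1, (k <= i)%N -> n i %| b i)%N /\
  exists c, forall i : 'I_m.+1, (i < k)%N -> b i = c * p ^ r i %[mod p ^ t i].
Proof.
move=> p_gt0 k_gt0 le_km n_gt0 le_rt nE le_u.
rewrite /F !mulf_eq0 !negb_or => /andP[/andP[q_neq0 /prodf_neq0 s_neq0]].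
move=> /prodf_neq0 z_neq0; split=> [i le_ki|].
  have := z_neq0 i le_ki; rewrite geometric_sum_zeta //.
  by case: ifP => //; rewrite eqxx.
(* A single [c] is sought for the indices up to [l]; the factor in [q] starts the induction and the
   sum over [s_l] extends it to [l.+1]. *)
suff glue l : (l < k)%N -> exists c, forall i : 'I_m.+1, (i <= l)%N ->
    b i = c * p ^ r i %[mod p ^ t i].
  have [|c bE] := glue k.-1; first by rewrite prednK.
  by exists c => i lt_ik; apply: bE; rewrite -ltnS prednK.
elim: l => [_|l IH lt_lk].
  move: q_neq0; rewrite geometric_sum_F_q ?le_rt ?nE //.
  case: ifP => [/dvdnP[c bE] _|]; last by rewrite eqxx.
  exists c => i; rewrite leqn0 => /eqP i0.
  have -> : i = ord0 by apply: ord_inj; rewrite i0.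
  by rewrite bE.
have [c bE] := IH (ltnW lt_lk).
have lt_lm : (l.+1 < m.+1)%N := leq_trans lt_lk le_km.
pose i : 'I_m.+1 := Ordinal (ltnW lt_lm).
have iS : ordS i = l.+1 :> nat := @val_ordS m i lt_lm.
have := s_neq0 i lt_lk.
rewrite (@geometric_sum_F_s R m p r t n b i c) ?le_rt ?nE ?le_u ?bE ?iS //=;
  try exact: ltnW.
case: ifP => [/eqP bS _|]; last by rewrite eqxx.
have [c' bS' cc'] := prime_power_glue p_gt0 bS.
exists c' => j; rewrite leq_eqVlt => /orP[/eqP jE|lt_jl].
  by have -> : j = ordS i; [apply: ord_inj; rewrite jE iS | rewrite bS'].
rewrite bE //.
have lt_jk : (j < k)%N := ltn_trans lt_jl lt_lk.
(* At an earlier index [j], only the class of the multiplier modulo [p ^ (t j - r j)] matters. By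
   monotonicity this divides [p ^ (t i - r i)], modulo which [c'] and [c] agree. *)
rewrite -{1 2}(subnK (le_rt j lt_jk)) expnD -!muln_modl; congr (_ * _)%N.
have dvd_u : (p ^ (t j - r j) %| p ^ (t i - r i))%N.
  by rewrite dvdn_exp2l // le_u // ltnW.
by rewrite -(modn_dvdm c dvd_u) -cc' modn_dvdm.
Qed.

(** Coordinate [i] of [g] has order [p ^ (t i - r i)] for [i <= k]. These orders divide one another
    in turn, so the last one is the order of [g]. *)
Lemma order_prime_power_coordinates (m p k : nat) (n r t : 'I_m.+1 -> nat)
    (g : Zsum n) :
  (0 < p)%N -> (k < m.+1)%N -> (forall i, 0 < n i)%N ->
  (forall i : 'I_m.+1, i <= k -> r i <= t i)%N ->
  (forall i : 'I_m.+1, (i <= k)%N -> n i = (p ^ t i)%N) ->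
  (forall i : 'I_m.+1, (i <= k)%N -> coordinate g i = (p ^ r i)%N) ->
  (forall i : 'I_m.+1, (k < i)%N -> coordinate g i = 0%N) ->
  (forall i j : 'I_m.+1, i <= j -> j <= k -> t i - r i <= t j - r j)%N ->
  #[g]%g = (p ^ (t (inord k) - r (inord k)))%N.
Proof.
move=> p_gt0 lt_km n_gt0 le_rt nE gE g0 le_u.
have kE : (inord k : 'I_m.+1) = k :> nat by rewrite inordK.
have nE' (i : 'I_m.+1) : (i <= k)%N -> n i = (p ^ (t i - r i) * p ^ r i)%N.
  by move=> le_ik; rewrite nE // -expnD subnK // le_rt.
apply/eqP; rewrite eqn_dvd; apply/andP; split.
  apply/Zsum_order_dvdn => // i; have [le_ik|lt_ki] := leqP i k.
    by rewrite nE' // gE // dvdn_mul // dvdn_exp2l // le_u ?kE.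
  by rewrite g0 // muln0 dvdn0.
have /(Zsum_order_dvdn _ _ n_gt0)/(_ (inord k)) := dvdnn #[g]%g.
by rewrite nE' ?gE ?kE // dvdn_pmul2r // expn_gt0 p_gt0.
Qed.

Theorem theorem1 (R : realType) (m : nat) (q : 'I_m.+1 -> nat)
    (hq : forall i : 'I_m.+1, prime_power (q i))
    (X : finType) (to : {action Zsum q &-> X}) (x : X)
    (k p : nat) (hk1 : (1 <= k)%N) (hkm : (k <= m.+1)%N) (hp : prime p)
    (r t : 'I_m.+1 -> nat) (g : Gprime to x)
    (hstab : 'C[orbit_base to x | Gprime_action to x]%g = <[g]>%g)
    (hg0 : forall i : 'I_m.+1, (k <= i)%N -> coordinate g i = 0%N)
    (hgn0 : forall i : 'I_m.+1, (i < k)%N -> coordinate g i <> 0%N)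
    (hgr : forall i : 'I_m.+1, (i < k)%N -> coordinate g i = (p ^ r i)%N)
    (hnt : forall i : 'I_m.+1, (i < k)%N -> period to x i = (p ^ t i)%N)
    (hmono : forall i j : 'I_m.+1, (i <= j)%N -> (j < k)%N ->
       (t i - r i <= t j - r j)%N)
    (b : Gprime to x) :
  (#|'Fix_([set: orbit_type to x] | Gprime_action to x)[b]%g|)%:R =
  F p k r t (period to x) (fun i => zeta R (period to x i) ^+ coordinate b i).
Proof.
have q_gt0 i : (0 < q i)%N.
  by case: (hq i) => p' [e [p'_prime _ ->]]; rewrite expn_gt0 prime_gt0.
have n_gt0 i : (0 < period to x i)%N := period_gt0 to x i.
have p_gt0 := prime_gt0 hp.
have le_rt (i : 'I_m.+1) : (i < k)%N -> (r i <= t i)%N.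
  (* A representative is smaller than its modulus, so [p ^ r i < p ^ t i]. *)
  move=> lt_ik; rewrite ltnW // -(ltn_exp2l _ _ (prime_gt1 hp)) -hgr // -hnt //.
  exact: ltn_coordinate.
have abG : abelian [set: Gprime to x].
  by apply/centsP => a _ c _; exact: Zsum_mulC.
have trG := Gprime_transitive to x q_gt0.
rewrite (card_fix_transitive_abelian b abG trG) hstab.
(* Orbit-stabilizer for the transitive action of G'. *)
have card_orbit_type :
    (#|orbit_type to x| * #[g]%g = \prod_(i < m.+1) period to x i)%N.
  rewrite -(card_Zsum n_gt0) -[RHS]cardsT.
  rewrite -(card_orbit_stab (Gprime_action to x) _ (orbit_base to x)).
  by rewrite trG cardsT finset.setTI hstab.
(* The order and telescoping lemmas are indexed by the last nonzero coordinate [k'], not by the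
   number [k] of such coordinates. *)
have [k' kE] : exists k', k = k'.+1 by exists k.-1; rewrite prednK.
case: Zsum_cycleP => // [[c bE]|not_mem].
  rewrite (@F_eq_card R m p k r t _ _ c) // => [|i lt_ik|i le_ki]; first last.
  - by rewrite bE hg0 // muln0 mod0n.
  - by rewrite bE hgr // hnt // modn_mod.
  congr (_%:R); apply/eqP.
  (* Multiplying by the order of [g] avoids a division: both sides become the product of all
     periods. *)
  rewrite -(@eqn_pmul2r #[g]%g) ?order_gt0 // card_orbit_type mulnAC.
  rewrite (@order_prime_power_coordinates m p k' _ r t); subst k => //.
  rewrite prod_exponents_telescope //.
  rewrite (bigID (fun i : 'I_m.+1 => i <= k')%N) /=; apply/eqP; congr (_ * _)%N.
    by apply: eq_bigr => i le_ik; rewrite hnt.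
  by apply: eq_bigl => i; rewrite -ltnNge.
apply/esym/eqP; apply/negPn/negP => F_neq0; case: not_mem.
have [b0 [c bE]] := F_neq0_congruence p_gt0 hk1 hkm n_gt0 le_rt hnt hmono F_neq0.
exists c => i; have lt_bi := ltn_coordinate b (n_gt0 i).
have [lt_ik|le_ki] := ltnP i k.
  by rewrite hgr // -(modn_small lt_bi) hnt // bE.
rewrite hg0 // muln0 mod0n; apply/eqP; rewrite -leqn0 leqNgt; apply/negP => b_gt0.
by have := dvdn_leq b_gt0 (b0 i le_ki); rewrite leqNgt lt_bi.
Qed.
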